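(* Let $c>0$ be a real number. There exists a finite non-empty subset $A_c$ of $\mathbb{Z}^2$ such that, in the Cayley graph of $\mathbb{Z}^2$ (with respect to the standard generators $(1,0)$ and $(0,1)$), $$\frac{|\partial A_c|}{|A_c|}<\frac{c}{\operatorname{depth}(A_c)}.$$
   Context: The Cayley graph of $\mathbb{Z}^2$ is the graph with vertex set $V=\mathbb{Z}^2$ in which two vertices are adjacent iff their difference is $(\pm1,0)$ or $(0,\pm1)$. Let $X=(V,E)$ be a connected graph. $d(u,v)$ denotes the graph distance, i.e. the minimum number of edges of a path joining $u$ to $v$ (and $0$ if $u=v$), and $d(v,B)=\inf\{d(v,u)\mid u\in B\}$ for a non-empty set $B\subset V$. For a non-empty $A\subset V$, the boundary of $A$ is the outer vertex boundary $$\partial A=\{u\in V\setminus A\mid \{u,v\}\in E\text{ for some }v\in A\},$$ and the depth of $A$ is $\operatorname{depth}(A)=\sup\{d(u,V\setminus A)\mid u\in A\}$. $|\cdot|$ denotes the number of vertices. *)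

(* Defs.v *)
From mathcomp Require Import all_boot all_order all_algebra.
From mathcomp Require Import all_classical all_reals all_analysis.

Set Implicit Arguments.
Unset Strict Implicit.
Unset Printing Implicit Defensive.

Import Order.TTheory GRing.Theory Num.Theory.

Local Open Scope classical_set_scope.
Local Open Scope ring_scope.

(* A graph on V is given by its adjacency relation. Distances, depths and
   cardinalities take values in \bar R, so that no infimum or supremum has to be
   given a conventional value: d(u, v) = +oo when no path joins u to v,
   d(v, set0) = +oo, and the number of elements of an infinite set is +oo
   (this is the library's [counting]). *)
Section Graph.
Variables (V : choiceType) (adj : rel V) (R : realType).

(* The path u :: p has [size p] edges; p = [::] gives d(u, u) = 0. *)
Definition gdist (u v : V) : \bar R :=
  ereal_inf [set ((size p)%:R)%:E | p in [set p | path adj u p /\ last u p = v]].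

Definition gdist_set (v : V) (B : set V) : \bar R :=
  ereal_inf [set gdist v u | u in B].

Definition boundary (A : set V) : set V :=
  [set u | ~ A u /\ exists2 v, A v & adj u v].

Definition depth (A : set V) : \bar R :=
  ereal_sup [set gdist_set u (~` A) | u in A].

End Graph.

Definition adjZ2 : rel (int * int) :=
  fun u v => v - u \in [:: (1, 0); (-1, 0); (0, 1); (0, -1)].

(* Main.v *)
(** Perforating a large square along a sparse lattice makes it shallow at little
    cost in boundary. Remove from [0, k^2)^2 the k^2 points with both coordinates
    divisible by k: about k^4 points are left, each within distance 2k of a
    removed one, while the boundary has at most k^2 + 4k^2 points. Hence
    |boundary| * depth / |A| is O(1/k). *)
Require Import Defs.
From mathcomp Require Import all_boot all_order all_algebra.
From mathcomp Require Import all_classical all_reals all_analysis.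
From mathcomp Require Import zify ring lra.

Import Order.TTheory GRing.Theory Num.Theory.

Local Open Scope classical_set_scope.
Local Open Scope ring_scope.

(** Repetitions in [s] are harmless for an upper bound, so [holes] and [frame] never have to be
    shown duplicate-free. *)
Lemma le_counting_size (T : choiceType) (R : realType) (A : set T) (s : seq T) :
  (forall x, A x -> x \in s) -> (counting A <= ((size s)%:R : R)%:E)%E.
Proof.
move=> As; have finA : finite_set A.
  by apply: (@sub_finite_set _ _ [set` s]) => //; exact: finite_seq.
rewrite /counting asboolT// lee_fin ler_nat; apply: uniq_leq_size => // x.
by rewrite in_fset_set// => /set_mem/As.
Qed.

Lemma size_le_counting (T : choiceType) (R : realType) (A : set T) (s : seq T) :
  uniq s -> (forall x, x \in s -> A x) -> (((size s)%:R : R)%:E <= counting A)%E.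
Proof.
move=> us sA; rewrite /counting; case: asboolP => [finA|_]; last by rewrite leey.
rewrite lee_fin ler_nat; apply: uniq_leq_size => // x xs.
by rewrite in_fset_set//; apply/mem_set/sA.
Qed.

Lemma gdist_ge0 (V : choiceType) (adj : rel V) (R : realType) (u v : V) :
  (0 <= gdist adj R u v)%E.
Proof. by apply: le_ereal_inf_tmp => _ [p _ <-]; rewrite lee_fin. Qed.

Lemma gdist_set_ge0 (V : choiceType) (adj : rel V) (R : realType) v (B : set V) :
  (0 <= gdist_set adj R v B)%E.
Proof. by apply: le_ereal_inf_tmp => _ [u _ <-]; exact: gdist_ge0. Qed.

Lemma depth_ge0 (V : choiceType) (adj : rel V) (R : realType) (A : set V) :
  A !=set0 -> (0 <= depth adj R A)%E.
Proof.
move=> [u Au]; apply: (le_trans (gdist_set_ge0 _ adj R u (~` A))).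
by apply: ereal_sup_ubound; exists u.
Qed.

(** The walk lowers the first coordinate [m] times, then the second [n] times. One quadrant
    suffices, since points are later joined to a hole below and to the left. *)
Lemma gdistZ2_le (R : realType) (x y : int) (m n : nat) :
  (gdist adjZ2 R (x + m%:Z, y + n%:Z)%R (x, y) <= ((m + n)%:R)%:E)%E.
Proof.
suff [p pP [lp sp]] : exists2 p, path adjZ2 (x + m%:Z, y + n%:Z) p &
    last (x + m%:Z, y + n%:Z) p = (x, y) /\ size p = (m + n)%N.
  by apply: ereal_inf_lbound; exists p; rewrite ?sp.
elim: m => [|m IHm].
  elim: n => [|n [p pP [lp sp]]]; first by exists [::]; rewrite //= !addr0.
  exists ((x + 0%:Z, y + n%:Z) :: p); last by rewrite /= lp sp.
  rewrite /= pP andbT /adjZ2 !inE; apply/or4P/Or44.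
  by apply/eqP; congr pair => /=; lia.
have [p pP [lp sp]] := IHm.
exists ((x + m%:Z, y + n%:Z) :: p); last by rewrite /= lp sp.
rewrite /= pP andbT /adjZ2 !inE; apply/or4P/Or42.
by apply/eqP; congr pair => /=; lia.
Qed.

Definition box (N : nat) : seq (int * int) :=
  [seq (i%:Z, j%:Z) | i <- iota 0 N, j <- iota 0 N].

Definition holes (k : nat) : seq (int * int) :=
  [seq ((k * i)%:Z, (k * j)%:Z) | i <- iota 0 k, j <- iota 0 k].

(** The outer vertex boundary of the [N] by [N] square: its four sides, without corners such as
    [(-1, -1)], which have no neighbour in the square. *)
Definition frame (N : nat) : seq (int * int) :=
  [seq (i%:Z, -1) | i <- iota 0 N] ++ [seq (i%:Z, N%:Z) | i <- iota 0 N] ++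
  [seq (-1, i%:Z) | i <- iota 0 N] ++ [seq (N%:Z, i%:Z) | i <- iota 0 N].

Definition perforated (k : nat) : seq (int * int) :=
  [seq u <- box (k ^ 2) | u \notin holes k].

Lemma mem_box N (u : int * int) :
  (u \in box N) = (0 <= u.1 < N%:Z) && (0 <= u.2 < N%:Z).
Proof.
apply/idP/idP => [/allpairsP[[i j] /= []]|].
  by rewrite !mem_iota => iN jN -> /=; lia.
case: u => -[x|x] [y|y] /= xyN; try lia.
by apply/allpairsP; exists (x, y); rewrite !mem_iota; split => //=; lia.
Qed.

Lemma size_box N : size (box N) = (N * N)%N.
Proof. by rewrite size_allpairs size_iota. Qed.

Lemma box_uniq N : uniq (box N).
Proof.
by apply: allpairs_uniq => [||[a b] [c d] _ _ [-> ->]] //; exact: iota_uniq.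
Qed.

Lemma size_holes k : size (holes k) = (k * k)%N.
Proof. by rewrite size_allpairs size_iota. Qed.

Lemma size_frame N : size (frame N) = (4 * N)%N.
Proof. by rewrite !size_cat !size_map size_iota; lia. Qed.

Lemma size_perforated_ge k : (k ^ 4 - k ^ 2 <= size (perforated k))%N.
Proof.
have : (size [seq u <- box (k ^ 2) | u \in holes k] <= k * k)%N.
  rewrite -size_holes; apply: uniq_leq_size; first exact/filter_uniq/box_uniq.
  by move=> u; rewrite mem_filter => /andP[].
rewrite leq_subLR -mulnn => szh.
rewrite (expnM k 2 2) -[X in (X <= _)%N]mulnn -size_box -(count_predC (mem (holes k))).
by rewrite -!size_filter leq_add2r.
Qed.

Lemma boundary_perforated k (u : int * int) :
  boundary adjZ2 [set` perforated k] u -> u \in holes k ++ frame (k ^ 2).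
Proof.
rewrite /boundary /= => -[+ [v +]]; rewrite !mem_filter !mem_cat.
move=> /negP uP /andP[_ vbox] uv.
(* A boundary point that is not a hole lies outside the box, next to a point inside; the direction
   of the edge then determines the side of the frame. *)
case: (boolP (u \in holes k)) uP => //= _ ubox.
move: vbox ubox; rewrite !mem_box.
set N := (k ^ 2)%N; case: u v uv => [a b] [c d] /=.
rewrite /adjZ2 !inE => /or4P[] /eqP[e1 e2] cd ab.
- apply/orP; right; apply/orP; right; apply/orP; left.
  by apply/mapP; exists `|b|%N; rewrite ?mem_iota; [lia|congr pair; lia].
- do 3 (apply/orP; right).
  by apply/mapP; exists `|b|%N; rewrite ?mem_iota; [lia|congr pair; lia].
- apply/orP; left.
  by apply/mapP; exists `|a|%N; rewrite ?mem_iota; [lia|congr pair; lia].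
- apply/orP; right; apply/orP; left.
  by apply/mapP; exists `|a|%N; rewrite ?mem_iota; [lia|congr pair; lia].
Qed.

(** Rounding both coordinates down to multiples of [k] reaches a hole, at the cost of two remainders
    below [k]. *)
Lemma depth_perforated (R : realType) k : (0 < k)%N ->
  (depth adjZ2 R [set` perforated k] <= ((2 * k)%:R)%:E)%E.
Proof.
move=> k0; apply: ge_ereal_sup => _ [[x y] /= + <-].
rewrite mem_filter => /andP[_ /allpairsP[[i j] /= [+ + [-> ->]]]].
rewrite !mem_iota !add0n => ik jk.
set h : int * int := ((k * (i %/ k))%:Z, (k * (j %/ k))%:Z).
(* Both quotients are below [k] because [i] and [j] are below [k ^ 2]. *)
have hP : h \in holes k.
  by apply/allpairsP; exists (i %/ k, j %/ k)%N; rewrite !mem_iota/= !add0n;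
     split => //; rewrite ltn_divLR// mulnn.
apply: (@le_trans _ _ (gdist adjZ2 R (i%:Z, j%:Z) h)).
  by apply: ereal_inf_lbound; exists h => //=; rewrite mem_filter hP.
rewrite {1}(divn_eq i k) {1}(divn_eq j k) !PoszD ![(_ %/ k * k)%N]mulnC.
apply: (le_trans (gdistZ2_le _ _ _ _ _)).
rewrite lee_fin ler_nat.
by have := ltn_pmod i k0; have := ltn_pmod j k0; lia.
Qed.

Theorem proposition1p1 (R : realType) (c : R) (hc : 0 < c) :
  exists A : set (int * int),
    [/\ finite_set A, A !=set0 &
      (counting (boundary adjZ2 A) / counting A < c%:E / depth adjZ2 R A)%E].
Proof.
(* The goal will reduce to [5k^2 * 2k < c(k^4 - k^2)], whence the constant 10. Taking [k = n + 2]
   gives [k - 1 > 10 / c] and also [k >= 2], so that [k^4 - k^2 > 0]. *)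
pose n := Num.bound (10 / c).
have hn : 10 / c < n%:R by apply: archi_boundP; rewrite divr_ge0// ltW.
pose k := n.+2.
exists [set` perforated k].
have szA := size_perforated_ge k.
have A0 : [set` perforated k] !=set0.
  case E: (perforated k) szA => [|u s] /=; last by exists u; rewrite /= inE eqxx.
  by rewrite leqn0 subn_eq0 leq_exp2l.
split => //.
set a : R := (k ^ 4 - k ^ 2)%:R; set b : R := (5 * k ^ 2)%:R.
have kR : 2 <= k%:R :> R by rewrite ler_nat.
have aE : a = k%:R ^+ 4 - k%:R ^+ 2 by rewrite /a natrB ?natrX// leq_exp2l.
have bE : b = 5 * k%:R ^+ 2 by rewrite /b natrM natrX.
have a0 : 0 < a by rewrite ltr0n subn_gt0 ltn_exp2l.
have Ab : (counting (boundary adjZ2 [set` perforated k]) <= b%:E)%E.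
  apply: le_trans (le_counting_size _ _ _ _ (boundary_perforated k)) _.
  by rewrite size_cat size_holes size_frame lee_fin ler_nat mulnn -mulSn.
have aA : (a%:E <= counting [set` perforated k])%E.
  apply: (@le_trans _ _ (((size (perforated k))%:R : R)%:E)).
    by rewrite lee_fin ler_nat.
  apply: size_le_counting => //; exact/filter_uniq/box_uniq.
have A_gt0 : (0 < counting [set` perforated k] :> \bar R)%E.
  by apply: lt_le_trans aA; rewrite lte_fin.
have dA := depth_perforated R k isT.
apply: (@le_lt_trans _ _ (b%:E / a%:E)%E).
  apply: lee_pmul => //.
  (* The empty list yields nonnegativity of the count. *)
  - exact: (@size_le_counting _ _ _ [::]).
  - by rewrite inve_ge0 ltW.
  - by rewrite lee_pV2// inE ?lee_fin ltW.
apply: (@lt_le_trans _ _ (c%:E / ((2 * k)%:R)%:E)%E); last first.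
  apply: lee_wpmul2l; first by rewrite lee_fin ltW.
  (* Inversion on [\bar R] is decreasing on all of [[0, +oo]], with 0 sent to [+oo], so
     nonnegativity of the depth is enough. *)
  by rewrite lee_pV2// inE ?lee_fin// depth_ge0.
rewrite !inver !gt_eqF// -!EFinM lte_fin natrM.
rewrite ltr_pdivrMr// mulrAC ltr_pdivlMr ?mulr_gt0//.
have {}hn : 10 < c * (k%:R - 1).
  move: hn; rewrite ltr_pdivrMr// => /lt_trans; apply.
  by rewrite mulrC ltr_pM2l// /k -addn2 natrD; lra.
(* Factoring out [k - 1] isolates the quantity bounded by [hn]; what remains is
   [10k^3 < 10k^2(k + 1)]. *)
have -> : c * a = c * (k%:R - 1) * (k%:R ^+ 2 * (k%:R + 1)) by rewrite aE; ring.
rewrite bE.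
set K : R := k%:R in kR hn *.
apply: (@lt_trans _ _ (10 * (K ^+ 2 * (K + 1)))).
  have -> : 5 * K ^+ 2 * (2 * K) = 10 * (K ^+ 2 * K) by ring.
  by rewrite !ltr_pM2l ?exprn_gt0//; lra.
by rewrite ltr_pM2r// mulr_gt0 ?exprn_gt0//; lra.
Qed.
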